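(* Let $X$ be a Polish space. For the generic compact set $K\subseteq X$ (that is, for all $K$ in a co-meager subset of $(\mathcal{K}(X),d_H)$), either $K$ is finite or there is a continuous gauge function $h$ such that $0<\mathcal{H}^{h}(K)<\infty$.
   Context: $\mathcal{K}(X)$ denotes the set of non-empty compact subsets of $X$ with the Hausdorff metric $d_H(K_1,K_2)=\min\{r: K_1\subseteq B(K_2,r),\ K_2\subseteq B(K_1,r)\}$, where $B(A,r)=\{x: \operatorname{dist}(A,\{x\})\le r\}$; it is a Polish space. A property holds for the generic element of a complete metric space if the set of elements with the property is co-meager (contains a dense $G_\delta$ set). A gauge function is a function $h\colon[0,\infty)\to[0,\infty)$ that is non-decreasing, right-continuous, and satisfies $h(x)=0$ iff $x=0$. For $A\subseteq X$, $\mathcal{H}^h_\delta(A)=\inf\{\sum_{i=1}^\infty h(\operatorname{diam}A_i): A\subseteq\bigcup_i A_i,\ \operatorname{diam}A_i\le\delta\}$ (with $\operatorname{diam}\emptyset=0$) and $\mathcal{H}^h(A)=\lim_{\delta\to0+}\mathcal{H}^h_\delta(A)$ is the $h$-Hausdorff measure. *)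

(* Defs.v *)
From Stdlib Require Import Reals Lra List Classical ClassicalEpsilon.
Open Scope R_scope.

(** * Generic real infimum / supremum (classical, via [completeness]).
    Junk value 0 when the set is empty or unbounded (never used in those cases
    below except where documented). *)

Definition Rsup (S : R -> Prop) : R :=
  match excluded_middle_informative (bound S /\ exists x, S x) with
  | left H => proj1_sig (completeness S (proj1 H) (proj2 H))
  | right _ => 0
  end.

Definition Rinf (S : R -> Prop) : R := - Rsup (fun r => S (- r)).

Inductive ER : Type := Fin (r : R) | PInf.

(** Infimum of a set of reals bounded below (here: sums of non-negative
    terms), with inf of the empty set = +infinity. *)
Definition ER_inf (S : R -> Prop) : ER :=
  match excluded_middle_informative (exists x, S x) with
  | left _ => Fin (Rinf S)
  | right _ => PInf
  end.

Definition ER_sup (S : ER -> Prop) : ER :=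
  match excluded_middle_informative
          (S PInf \/ ~ bound (fun r => S (Fin r))) with
  | left _ => PInf
  | right _ => Fin (Rsup (fun r => S (Fin r)))
  end.

Definition is_metric {X : Type} (d : X -> X -> R) : Prop :=
  (forall x y, 0 <= d x y) /\
  (forall x y, d x y = 0 <-> x = y) /\
  (forall x y, d x y = d y x) /\
  (forall x y z, d x z <= d x y + d y z).

Definition cauchy_seq {X : Type} (d : X -> X -> R) (u : nat -> X) : Prop :=
  forall eps, 0 < eps -> exists N, forall m n, (N <= m)%nat -> (N <= n)%nat ->
    d (u m) (u n) < eps.

Definition converges_to {X : Type} (d : X -> X -> R) (u : nat -> X) (l : X) : Prop :=
  forall eps, 0 < eps -> exists N, forall n, (N <= n)%nat -> d (u n) l < eps.

Definition complete_metric {X : Type} (d : X -> X -> R) : Prop :=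
  forall u, cauchy_seq d u -> exists l, converges_to d u l.

Definition separable_metric {X : Type} (d : X -> X -> R) : Prop :=
  exists q : nat -> X, forall x eps, 0 < eps -> exists n, d x (q n) < eps.

Definition polish {X : Type} (d : X -> X -> R) : Prop :=
  is_metric d /\ complete_metric d /\ separable_metric d.

Definition open_set {X : Type} (d : X -> X -> R) (U : X -> Prop) : Prop :=
  forall x, U x -> exists eps, 0 < eps /\ forall y, d x y < eps -> U y.

Definition compact_set {X : Type} (d : X -> X -> R) (K : X -> Prop) : Prop :=
  forall (I : Type) (U : I -> X -> Prop),
    (forall i, open_set d (U i)) ->
    (forall x, K x -> exists i, U i x) ->
    exists l : list I, forall x, K x -> exists i, In i l /\ U i x.

Definition nonempty_set {X : Type} (A : X -> Prop) : Prop := exists x, A x.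

Definition finite_set {X : Type} (A : X -> Prop) : Prop :=
  exists l : list X, forall x, A x -> In x l.

Definition in_KX {X : Type} (d : X -> X -> R) (K : X -> Prop) : Prop :=
  compact_set d K /\ nonempty_set K.

Definition dist_set_pt {X : Type} (d : X -> X -> R) (A : X -> Prop) (x : X) : R :=
  Rinf (fun r => exists a, A a /\ r = d a x).

Definition Bset {X : Type} (d : X -> X -> R) (A : X -> Prop) (r : R) : X -> Prop :=
  fun x => dist_set_pt d A x <= r.

Definition subset {X : Type} (A B : X -> Prop) : Prop := forall x, A x -> B x.

(** d_H(K1,K2) = min{r : K1 ⊆ B(K2,r), K2 ⊆ B(K1,r)} (the min is attained for
    non-empty compact sets, so it coincides with the infimum used here). *)
Definition dH {X : Type} (d : X -> X -> R) (K1 K2 : X -> Prop) : R :=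
  Rinf (fun r => subset K1 (Bset d K2 r) /\ subset K2 (Bset d K1 r)).

Definition KX_open {X : Type} (d : X -> X -> R) (U : (X -> Prop) -> Prop) : Prop :=
  forall K, in_KX d K -> U K ->
    exists eps, 0 < eps /\ forall L, in_KX d L -> dH d K L < eps -> U L.

Definition KX_dense {X : Type} (d : X -> X -> R) (U : (X -> Prop) -> Prop) : Prop :=
  forall K eps, in_KX d K -> 0 < eps ->
    exists L, in_KX d L /\ dH d K L < eps /\ U L.

Definition KX_generic {X : Type} (d : X -> X -> R) (P : (X -> Prop) -> Prop) : Prop :=
  exists U : nat -> (X -> Prop) -> Prop,
    (forall n, KX_open d (U n) /\ KX_dense d (U n)) /\
    (forall K, in_KX d K -> (forall n, U n K) -> P K).

(** * Gauge functions (h : [0,oo) -> [0,oo); values on negatives irrelevant) *)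

Definition gauge (h : R -> R) : Prop :=
  (forall x, 0 <= x -> 0 <= h x) /\
  (forall x y, 0 <= x -> x <= y -> h x <= h y) /\
  (forall x, 0 <= x -> forall eps, 0 < eps -> exists del, 0 < del /\
       forall y, x <= y < x + del -> Rabs (h y - h x) < eps) /\
  (forall x, 0 <= x -> (h x = 0 <-> x = 0)).

Definition continuous_on_nonneg (h : R -> R) : Prop :=
  forall x, 0 <= x -> forall eps, 0 < eps -> exists del, 0 < del /\
    forall y, 0 <= y -> Rabs (y - x) < del -> Rabs (h y - h x) < eps.

(** diam A = sup {d x y : x, y in A} (only used for sets with diam <= delta). *)
Definition diam {X : Type} (d : X -> X -> R) (A : X -> Prop) : R :=
  Rsup (fun r => exists x y, A x /\ A y /\ r = d x y).

(** diam A <= delta (with diam of the empty set = 0). *)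
Definition diam_le {X : Type} (d : X -> X -> R) (A : X -> Prop) (delta : R) : Prop :=
  forall x y, A x -> A y -> d x y <= delta.

(** H^h_delta(A) = inf { sum_i h(diam A_i) : A ⊆ U_i A_i, diam A_i <= delta },
    where only covers with a finite (convergent) sum contribute a real value;
    the infimum of the empty set is +oo. *)
Definition hausdorff_delta {X : Type} (d : X -> X -> R) (h : R -> R)
    (delta : R) (A : X -> Prop) : ER :=
  ER_inf (fun s => exists F : nat -> X -> Prop,
            (forall i, diam_le d (F i) delta) /\
            (forall x, A x -> exists i, F i x) /\
            Un_cv (fun n => sum_f_R0 (fun i => h (diam d (F i))) n) s).

(** H^h(A) = lim_{delta -> 0+} H^h_delta(A) = sup_{delta > 0} H^h_delta(A)
    (H^h_delta is non-increasing in delta). *)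
Definition hausdorff_measure {X : Type} (d : X -> X -> R) (h : R -> R)
    (A : X -> Prop) : ER :=
  ER_sup (fun v => exists delta, 0 < delta /\ v = hausdorff_delta d h delta A).

(* Main.v *)
From Stdlib Require Import Reals Lra Lia List Cantor Classical ClassicalEpsilon.
Require Import Defs.
Import ListNotations.
Open Scope R_scope.

(** Call a pattern a finite set of centers, lying in a countable dense set, that are
    [s + 2 r]-separated, where [r = s / N] and [N] is the number of centers, and whose
    [r]-balls contain no isolated point of [X]. A compact set models the pattern if it
    consists of isolated points and of points in these balls, each ball being hit. There
    are countably many patterns, and modelling one is an open condition. Arbitrarily close
    to any compact set that models a pattern there is a finite set modelling a refinement
    in which each center is replaced by the same number [M >= 2] of nearby centers.
    Hence the generic compact set either consists of isolated points, and is then finite,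
    or models an infinite chain of refinements, with parameters [N_k], [s_k], [r_k].

    Such a chain spreads a unit mass evenly over the centers of each level, and a set of
    diameter [t < s_k] gets mass at most [1 / N_k]. So the concave gauge
    [h t = inf_k (1 / N_k + t / s_k)] dominates the mass, which gives [H^h(K) >= 1], while
    covering [K] by the balls of level [k] gives [H^h(K) <= N_k * h (2 r_k) <= 3]; the
    finitely many isolated points cost [h 0 = 0]. *)

(** * Real infima and suprema *)

Lemma Rsup_upper (S : R -> Prop) (m x : R) :
  (forall y, S y -> y <= m) -> S x -> x <= Rsup S.
Proof.
  intros Hm Hx. unfold Rsup. destruct excluded_middle_informative as [H|H].
  - destruct (completeness S (proj1 H) (proj2 H)) as [l [Hl Hl']]. simpl. now apply Hl.
  - exfalso. apply H. split; [exists m; exact Hm | now exists x].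
Qed.

Lemma Rsup_least (S : R -> Prop) (m : R) :
  (exists x, S x) -> (forall y, S y -> y <= m) -> Rsup S <= m.
Proof.
  intros Hx Hm. unfold Rsup. destruct excluded_middle_informative as [H|H].
  - destruct (completeness S (proj1 H) (proj2 H)) as [l [Hl' Hl]]. simpl. now apply Hl.
  - exfalso. apply H. split; [exists m; exact Hm | exact Hx].
Qed.

(** The junk value 0 is exactly what makes the diameter of the empty set 0. *)
Lemma Rsup_empty (S : R -> Prop) : (forall x, ~ S x) -> Rsup S = 0.
Proof.
  intros H. unfold Rsup. destruct excluded_middle_informative as [[Hb [x Hx]]|Hn];
    [now elim (H x) | reflexivity].
Qed.

Lemma Rinf_lower (S : R -> Prop) (m x : R) :
  (forall y, S y -> m <= y) -> S x -> Rinf S <= x.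
Proof.
  intros Hm Hx. unfold Rinf.
  enough (- x <= Rsup (fun r => S (- r))) by lra.
  apply (Rsup_upper _ (- m)); [|now rewrite Ropp_involutive].
  intros y Hy. apply Hm in Hy. lra.
Qed.

Lemma Rinf_greatest (S : R -> Prop) (m : R) :
  (exists x, S x) -> (forall y, S y -> m <= y) -> m <= Rinf S.
Proof.
  intros [x Hx] Hm. unfold Rinf.
  enough (Rsup (fun r => S (- r)) <= - m) by lra.
  apply Rsup_least; [exists (- x); now rewrite Ropp_involutive|].
  intros y Hy. apply Hm in Hy. lra.
Qed.

Lemma Rinf_lt (S : R -> Prop) (e : R) :
  (exists x, S x) -> Rinf S < e -> exists x, S x /\ x < e.
Proof.
  intros Hx He. apply NNPP. intros H.
  enough (e <= Rinf S) by lra.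
  apply Rinf_greatest; [exact Hx|]. intros y Hy.
  destruct (Rle_lt_dec e y) as [Hl|Hl]; [exact Hl|].
  exfalso. apply H. now exists y.
Qed.

(** * Choice and uniform thresholds *)

Lemma functional_choice {A B : Type} (P : A -> B -> Prop) :
  (forall a, exists b, P a b) -> exists f, forall a, P a (f a).
Proof.
  intros H. exists (fun a => proj1_sig (constructive_indefinite_description _ (H a))).
  intros a. apply proj2_sig.
Qed.

(** Since each threshold covers all smaller [t], the minimum of finitely many thresholds serves the
    whole list. Radii that must suit finitely many points at once are chosen this way. *)
Lemma uniform_threshold {A : Type} (P : A -> R -> Prop) (l : list A) :
  (forall a, In a l -> exists e, 0 < e /\ forall t, 0 < t <= e -> P a t) ->
  exists e, 0 < e /\ forall a t, In a l -> 0 < t <= e -> P a t.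
Proof.
  induction l as [|a l IH]; intros H.
  - exists 1. split; [lra|]. intros a t [].
  - destruct IH as [e1 [He1 H1]]; [intros b Hb; apply H; now right|].
    destruct (H a) as [e2 [He2 H2]]; [now left|].
    exists (Rmin e1 e2). split; [now apply Rmin_pos|].
    intros b t Hb Ht.
    pose proof (Rmin_l e1 e2). pose proof (Rmin_r e1 e2).
    destruct Hb as [<-|Hb]; [apply H2; lra | apply H1; [exact Hb|lra]].
Qed.

Lemma inv_INR_S_pos (n : nat) : 0 < / INR (S n).
Proof. apply Rinv_0_lt_compat, lt_0_INR. lia. Qed.

Lemma inv_INR_S_small (e : R) (n0 : nat) :
  0 < e -> exists n, (n0 < n)%nat /\ / INR (S n) <= e.
Proof.
  intros He. destruct (archimed_cor1 e He) as [N [HN HN0]].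
  exists (S (N + n0)). split; [lia|].
  apply Rle_trans with (/ INR N); [|lra].
  apply Rinv_le_contravar; [now apply lt_0_INR | apply le_INR; lia].
Qed.

(** * Gauge functions as infima of affine functions *)

Definition affine_inf (a b : nat -> R) (t : R) : R :=
  Rinf (fun v => exists k, v = a k + b k * t).

Lemma affine_inf_le (a b : nat -> R) (t : R) (k : nat) :
  (forall k, 0 < a k) -> (forall k, 1 <= b k) -> 0 <= t ->
  affine_inf a b t <= a k + b k * t.
Proof.
  intros Ha Hb Ht. apply (Rinf_lower _ 0); [|now exists k].
  intros y [j ->]. specialize (Ha j). specialize (Hb j). nra.
Qed.

Lemma affine_inf_ge (a b : nat -> R) (t v : R) :
  (forall k, v <= a k + b k * t) -> v <= affine_inf a b t.
Proof.
  intros H. apply Rinf_greatest; [now exists (a 0%nat + b 0%nat * t), 0%nat|].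
  now intros y [k ->].
Qed.

(** For a concave function that is non-negative at 0 the ratio of value to argument does not
    increase. Written as a bound on the increment, this is the modulus of continuity away from 0. *)
Lemma affine_inf_ratio (a b : nat -> R) (x y : R) :
  (forall k, 0 < a k) -> (forall k, 1 <= b k) -> 0 < x -> x <= y ->
  affine_inf a b y <= affine_inf a b x + (y - x) / x * affine_inf a b x.
Proof.
  intros Ha Hb Hx Hxy.
  assert (H : x / y * affine_inf a b y <= affine_inf a b x).
  { apply affine_inf_ge. intros k.
    pose proof (affine_inf_le a b y k Ha Hb ltac:(lra)) as Hle.
    apply Rle_trans with (x / y * (a k + b k * y)).
    - apply Rmult_le_compat_l; [|exact Hle].
      apply Rlt_le, Rdiv_lt_0_compat; lra.
    - replace (x / y * (a k + b k * y)) with (a k * (x / y) + b k * x) by (field; lra).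
      assert (x / y <= 1).
      { apply Rmult_le_reg_r with y; [lra|]. unfold Rdiv.
        rewrite Rmult_assoc, Rinv_l by lra. lra. }
      specialize (Ha k). nra. }
  apply Rmult_le_compat_l with (r := y / x) in H; [|apply Rlt_le, Rdiv_lt_0_compat; lra].
  replace (y / x * (x / y * affine_inf a b y)) with (affine_inf a b y) in H by (field; lra).
  replace (affine_inf a b x + (y - x) / x * affine_inf a b x)
    with (y / x * affine_inf a b x) by (field; lra).
  exact H.
Qed.

Section AffineGauge.
Context (a b : nat -> R) (Ha : forall k, 0 < a k) (Hb : forall k, 1 <= b k)
  (Ha0 : forall e, 0 < e -> exists k, a k < e).

(** Slopes of at least 1 keep the infimum positive away from 0. *)
Lemma affine_inf_ge_id (t : R) : 0 <= t -> t <= affine_inf a b t.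
Proof.
  intros Ht. apply affine_inf_ge. intros k. specialize (Ha k). specialize (Hb k). nra.
Qed.

Lemma affine_inf_mono (x y : R) : 0 <= x -> x <= y -> affine_inf a b x <= affine_inf a b y.
Proof.
  intros Hx Hxy. apply affine_inf_ge. intros k.
  pose proof (affine_inf_le a b x k Ha Hb Hx). specialize (Hb k). nra.
Qed.

Lemma affine_inf_0 : affine_inf a b 0 = 0.
Proof.
  apply Rle_antisym; [|apply affine_inf_ge_id; lra].
  apply Rnot_lt_le. intros H. destruct (Ha0 _ H) as [k Hk].
  pose proof (affine_inf_le a b 0 k Ha Hb ltac:(lra)). lra.
Qed.

Lemma affine_inf_continuous : continuous_on_nonneg (affine_inf a b).
Proof.
  intros x Hx e He. destruct Hx as [Hx|<-].
  - set (H := affine_inf a b x). assert (HH : 0 < H).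
    { pose proof (affine_inf_ge_id x ltac:(lra)). unfold H. lra. }
    (* The first bound keeps both points above [x / 2]; the second makes the increment, at most
       [(w - z) / z * H], less than [e]. *)
    exists (Rmin (x / 2) (e * x / (2 * H))).
    assert (Hp : 0 < e * x / (2 * H)) by (apply Rdiv_lt_0_compat; nra).
    split; [apply Rmin_pos; lra|]. intros y Hy Hyx.
    pose proof (Rmin_l (x / 2) (e * x / (2 * H))). pose proof (Rmin_r (x / 2) (e * x / (2 * H))).
    assert (key : forall z w, x / 2 < z -> z <= w -> w - z < e * x / (2 * H) ->
      affine_inf a b z <= H -> affine_inf a b w - affine_inf a b z < e).
    { intros z w Hz Hzw Hlt Hle.
      pose proof (affine_inf_ratio a b z w Ha Hb ltac:(lra) Hzw).
      enough ((w - z) / z * affine_inf a b z < e) by lra.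
      pose proof (affine_inf_ge_id z ltac:(lra)).
      apply Rle_lt_trans with ((w - z) / z * H).
      - apply Rmult_le_compat_l; [|exact Hle].
        apply Rmult_le_pos; [lra|]. apply Rlt_le, Rinv_0_lt_compat. lra.
      - apply Rmult_lt_reg_r with z; [lra|].
        replace ((w - z) / z * H * z) with ((w - z) * H) by (field; lra).
        apply Rlt_trans with (e * x / (2 * H) * H); [apply Rmult_lt_compat_r; lra|].
        replace (e * x / (2 * H) * H) with (e * (x / 2)) by (field; lra).
        apply Rmult_lt_compat_l; lra. }
    apply Rabs_def2 in Hyx. destruct (Rle_lt_dec x y) as [Hxy|Hxy].
    + pose proof (affine_inf_mono x y ltac:(lra) Hxy) as Hm. fold H in Hm.
      rewrite Rabs_right by lra. apply (key x y); try lra. apply Rle_refl.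
    + pose proof (affine_inf_mono y x Hy ltac:(lra)) as Hm. fold H in Hm.
      rewrite Rabs_left1 by lra.
      pose proof (key y x ltac:(lra) ltac:(lra) ltac:(lra) Hm) as Hk. fold H in Hk. lra.
  (* At 0 a single affine function with small intercept controls the infimum. *)
  - destruct (Ha0 (e / 2)) as [k Hk]; [lra|].
    pose proof (Hb k) as Hbk.
    exists (e / (2 * b k)). split; [apply Rdiv_lt_0_compat; lra|].
    intros y Hy Hyx. rewrite affine_inf_0, !Rminus_0_r in *.
    rewrite Rabs_right in Hyx by lra.
    pose proof (affine_inf_ge_id y Hy). rewrite Rabs_right by lra.
    pose proof (affine_inf_le a b y k Ha Hb Hy).
    assert (b k * y < e / 2); [|lra].
    replace (e / 2) with (b k * (e / (2 * b k))) by (field; lra).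
    apply Rmult_lt_compat_l; lra.
Qed.

Lemma affine_inf_gauge : gauge (affine_inf a b).
Proof.
  split; [|split; [|split]].
  - intros x Hx. pose proof (affine_inf_ge_id x Hx). lra.
  - exact affine_inf_mono.
  - intros x Hx e He. destruct (affine_inf_continuous x Hx e He) as [f [Hf H]].
    exists f. split; [exact Hf|]. intros y Hy. apply H; [lra|]. apply Rabs_def1; lra.
  - intros x Hx. split; intros H.
    + pose proof (affine_inf_ge_id x Hx). lra.
    + subst x. exact affine_inf_0.
Qed.
End AffineGauge.

(** * Elementary facts about a metric *)

Section Metric.
Context {X : Type} (d : X -> X -> R) (Hd : is_metric d).

Lemma metric_pos x y : 0 <= d x y.
Proof. apply Hd. Qed.

Lemma metric_refl x : d x x = 0.
Proof. now apply Hd. Qed.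

Lemma metric_eq x y : d x y = 0 -> x = y.
Proof. apply Hd. Qed.

Lemma metric_sym x y : d x y = d y x.
Proof. apply Hd. Qed.

Lemma metric_triangle x y z : d x z <= d x y + d y z.
Proof. apply Hd. Qed.

Lemma metric_neq_pos x y : x <> y -> 0 < d x y.
Proof.
  intros H. destruct (metric_pos x y) as [Hp|Hp]; [exact Hp|].
  exfalso. apply H, metric_eq. now symmetry.
Qed.

Lemma open_ball x e : open_set d (fun y => d x y < e).
Proof.
  intros y Hy. exists (e - d x y). split; [lra|].
  intros z Hz. pose proof (metric_triangle x y z). lra.
Qed.

(** * Compact sets and the Hausdorff metric *)

Lemma compact_finite (A : X -> Prop) : finite_set A -> compact_set d A.
Proof.
  intros [l Hl] I U _ HU.
  enough (exists l' : list I, forall x, In x l -> A x -> exists i, In i l' /\ U i x) as [l' H].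
  { exists l'. intros x Hx. apply H; auto. }
  clear Hl. induction l as [|a l [l' IH]].
  - exists []. intros x [].
  - destruct (classic (A a)) as [Ha|Ha].
    + destruct (HU a Ha) as [i Hi]. exists (i :: l').
      intros x [<-|Hx] HAx; [exists i; split; [now left|exact Hi]|].
      destruct (IH x Hx HAx) as [j [Hj HUj]]. exists j. split; [now right|exact HUj].
    + exists l'. intros x [<-|Hx] HAx; [contradiction|]. now apply IH.
Qed.

Lemma compact_net (K : X -> Prop) (e : R) :
  compact_set d K -> 0 < e ->
  exists l, forall x, K x -> exists y, In y l /\ d y x < e.
Proof.
  intros HK He. apply (HK X (fun y x => d y x < e)).
  - intros y. apply open_ball.
  - intros x _. exists x. now rewrite metric_refl.
Qed.

(** [A] may fail to be closed, so the net is first taken for [K] with half the radius; each of its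
    points that is close to [A] is then moved into [A]. *)
Lemma subset_net (K A : X -> Prop) (e : R) :
  compact_set d K -> subset A K -> 0 < e ->
  exists l, (forall y, In y l -> A y) /\ forall x, A x -> exists y, In y l /\ d y x < e.
Proof.
  intros HK HA He. destruct (compact_net K (e / 2) HK) as [l Hl]; [lra|].
  enough (exists l', (forall y, In y l' -> A y) /\
    forall z x, In z l -> A x -> d z x < e / 2 -> exists y, In y l' /\ d y x < e)
    as [l' [H1 H2]].
  { exists l'. split; [exact H1|]. intros x Hx.
    destruct (Hl x (HA x Hx)) as [z [Hz Hzx]]. now apply (H2 z). }
  clear Hl. induction l as [|a l [l' [IH1 IH2]]].
  - exists []. split; [intros y []|intros z x []].
  - destruct (classic (exists b, A b /\ d a b < e / 2)) as [[b [Hb Hab]]|Hn].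
    + exists (b :: l'). split; [intros y [<-|Hy]; auto|].
      intros z x [<-|Hz] Hx Hzx.
      * exists b. split; [now left|].
        pose proof (metric_triangle b a x). rewrite (metric_sym b a) in *. lra.
      * destruct (IH2 z x Hz Hx Hzx) as [y [Hy Hyx]]. exists y. split; [now right|exact Hyx].
    + exists l'. split; [exact IH1|].
      intros z x [<-|Hz] Hx Hzx; [exfalso; apply Hn; now exists x|].
      now apply (IH2 z x).
Qed.

Lemma compact_bounded (K : X -> Prop) (a : X) :
  compact_set d K -> exists M, forall x, K x -> d a x <= M.
Proof.
  intros HK. destruct (compact_net K 1 HK ltac:(lra)) as [l Hl].
  enough (exists M, forall y, In y l -> d a y <= M) as [M HM].
  { exists (M + 1). intros x Hx. destruct (Hl x Hx) as [y [Hy Hyx]].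
    pose proof (metric_triangle a y x). pose proof (HM y Hy). lra. }
  clear Hl. induction l as [|b l [M HM]].
  - exists 0. intros y [].
  - exists (Rmax M (d a b)). intros y [<-|Hy]; [apply Rmax_r|].
    eapply Rle_trans; [now apply HM|apply Rmax_l].
Qed.

Lemma lebesgue_number (K U : X -> Prop) :
  compact_set d K -> open_set d U -> subset K U ->
  exists e, 0 < e /\ forall x y, K x -> d x y < e -> U y.
Proof.
  intros HK HU HKU.
  (* Each point is covered by a ball of half the radius that fits into [U]; the other half is left
     for moving away from the point. *)
  destruct (HK (X * R)%type (fun p x => d (fst p) x < snd p /\
      0 < snd p /\ forall y, d (fst p) y < 2 * snd p -> U y)) as [l Hl].
  - intros [z e] x [Hx He]. destruct (open_ball z e x Hx) as [f [Hf H]].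
    exists f. split; [exact Hf|]. intros y Hy. split; [now apply H|exact He].
  - intros x Hx. destruct (HU x (HKU x Hx)) as [e [He H]].
    exists (x, e / 2). simpl. rewrite metric_refl. split; [lra|split; [lra|]].
    intros y Hy. apply H. lra.
  (* The finite list may contain pairs with a non-positive radius. They index empty sets, and the
     premise [0 < snd p] skips them. *)
  - destruct (uniform_threshold (fun (p : X * R) t => 0 < snd p -> t <= snd p) l)
      as [e [He H]].
    { intros [z e] _. simpl. destruct (Rlt_le_dec 0 e) as [Hp|Hp].
      - exists e. split; [exact Hp|]. intros t Ht _. lra.
      - exists 1. split; [lra|]. intros t _ Hn. lra. }
    exists e. split; [exact He|]. intros x y Hx Hxy.
    destruct (Hl x Hx) as [[z f] [Hin [H1 [H2 H3]]]]. simpl in *.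
    pose proof (H (z, f) e Hin ltac:(lra) H2) as Hef. simpl in Hef.
    apply H3. pose proof (metric_triangle z x y). lra.
Qed.

Lemma dist_set_pt_le (A : X -> Prop) (a x : X) : A a -> dist_set_pt d A x <= d a x.
Proof.
  intros Ha. apply (Rinf_lower _ 0); [|now exists a].
  intros y [b [_ ->]]. apply metric_pos.
Qed.

Lemma dist_set_pt_pos (A : X -> Prop) (x : X) : nonempty_set A -> 0 <= dist_set_pt d A x.
Proof.
  intros [a Ha]. apply Rinf_greatest; [now exists (d a x), a|].
  intros y [b [_ ->]]. apply metric_pos.
Qed.

Lemma dist_set_pt_lt (A : X -> Prop) (x : X) (e : R) :
  nonempty_set A -> dist_set_pt d A x < e -> exists a, A a /\ d a x < e.
Proof.
  intros [a Ha] He. destruct (Rinf_lt _ e (ex_intro _ (d a x) (ex_intro _ a (conj Ha eq_refl))) He)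
    as [y [[b [Hb ->]] Hy]].
  now exists b.
Qed.

Lemma dH_le (K L : X -> Prop) (e : R) :
  nonempty_set K -> nonempty_set L ->
  (forall x, K x -> exists y, L y /\ d x y <= e) ->
  (forall y, L y -> exists x, K x /\ d x y <= e) ->
  dH d K L <= e.
Proof.
  intros [a Ha] HL H1 H2. apply (Rinf_lower _ 0).
  - intros r [Hr _]. apply Rle_trans with (2 := Hr a Ha). now apply dist_set_pt_pos.
  - split; intros x Hx.
    + destruct (H1 x Hx) as [y [Hy Hxy]]. rewrite metric_sym in Hxy.
      apply Rle_trans with (2 := Hxy). now apply dist_set_pt_le.
    + destruct (H2 x Hx) as [y [Hy Hxy]].
      apply Rle_trans with (2 := Hxy). now apply dist_set_pt_le.
Qed.

Lemma dH_lt (K L : X -> Prop) (e : R) :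
  in_KX d K -> in_KX d L -> dH d K L < e ->
  (forall x, K x -> exists y, L y /\ d x y < e) /\
  (forall y, L y -> exists x, K x /\ d x y < e).
Proof.
  intros [HK [a Ha]] [HL [b Hb]] H.
  (* An infimum over no admissible radius would be the junk value 0; boundedness of compact sets
     excludes this. *)
  assert (Hne : exists r, subset K (Bset d L r) /\ subset L (Bset d K r)).
  { destruct (compact_bounded K b HK) as [M1 HM1].
    destruct (compact_bounded L a HL) as [M2 HM2].
    exists (Rmax M1 M2). split; intros x Hx.
    + apply Rle_trans with (d b x); [now apply dist_set_pt_le|].
      eapply Rle_trans; [now apply HM1|apply Rmax_l].
    + apply Rle_trans with (d a x); [now apply dist_set_pt_le|].
      eapply Rle_trans; [now apply HM2|apply Rmax_r]. }
  destruct (Rinf_lt _ e Hne H) as [r [[H1 H2] Hr]].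
  split; intros x Hx.
  - destruct (dist_set_pt_lt L x e) as [y [Hy Hyx]]; [now exists b| |].
    + pose proof (H1 x Hx) as Hle. unfold Bset in Hle. lra.
    + exists y. now rewrite metric_sym.
  - apply dist_set_pt_lt; [now exists a|].
    pose proof (H2 x Hx) as Hle. unfold Bset in Hle. lra.
Qed.

Lemma dH_refl_lt (K : X -> Prop) (e : R) : nonempty_set K -> 0 < e -> dH d K K < e.
Proof.
  intros HK He. apply Rle_lt_trans with 0; [|exact He].
  apply dH_le; try assumption; intros x Hx; exists x; rewrite metric_refl; split; auto; lra.
Qed.

Lemma dH_triangle_lt (K L M : X -> Prop) (e1 e2 : R) :
  in_KX d K -> in_KX d L -> in_KX d M ->
  dH d K L < e1 -> dH d L M < e2 -> dH d K M <= e1 + e2.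
Proof.
  intros HK HL HM H1 H2.
  destruct (dH_lt _ _ _ HK HL H1) as [A1 B1]. destruct (dH_lt _ _ _ HL HM H2) as [A2 B2].
  apply dH_le; [apply HK|apply HM| |].
  - intros x Hx. destruct (A1 x Hx) as [y [Hy Hxy]]. destruct (A2 y Hy) as [z [Hz Hyz]].
    exists z. split; [exact Hz|]. pose proof (metric_triangle x y z). lra.
  - intros z Hz. destruct (B2 z Hz) as [y [Hy Hyz]]. destruct (B1 y Hy) as [x [Hx Hxy]].
    exists x. split; [exact Hx|]. pose proof (metric_triangle x y z). lra.
Qed.

(** * Open conditions on compact sets *)

Lemma KX_open_and (P Q : (X -> Prop) -> Prop) :
  KX_open d P -> KX_open d Q -> KX_open d (fun K => P K /\ Q K).
Proof.
  intros HP HQ K HK [H1 H2].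
  destruct (HP K HK H1) as [e1 [He1 A1]]. destruct (HQ K HK H2) as [e2 [He2 A2]].
  exists (Rmin e1 e2). split; [now apply Rmin_pos|]. intros L HL HKL.
  pose proof (Rmin_l e1 e2). pose proof (Rmin_r e1 e2).
  split; [apply A1|apply A2]; auto; lra.
Qed.

Lemma KX_open_forall_list {A : Type} (P : A -> (X -> Prop) -> Prop) (l : list A) :
  (forall a, KX_open d (P a)) -> KX_open d (fun K => forall a, In a l -> P a K).
Proof.
  intros HP K HK H.
  destruct (uniform_threshold
    (fun a t => forall L, in_KX d L -> dH d K L < t -> P a L) l) as [e [He HL]].
  - intros a Ha. destruct (HP a K HK (H a Ha)) as [e [He HL]].
    exists e. split; [exact He|]. intros t Ht L HL1 HL2. apply HL; [exact HL1|lra].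
  - exists e. split; [exact He|]. intros L HL1 HL2 a Ha. apply (HL a e); auto; lra.
Qed.

(** This and [KX_open_hits] are the subbasic open sets of the Vietoris topology. Here a Lebesgue
    number of [K] in [U] gives the radius. *)
Lemma KX_open_subset (U : X -> Prop) : open_set d U -> KX_open d (fun K => subset K U).
Proof.
  intros HU K HK HKU. destruct (lebesgue_number K U) as [e [He H]]; auto; [apply HK|].
  exists e. split; [exact He|]. intros L HL HKL y Hy.
  destruct (proj2 (dH_lt K L e HK HL HKL) y Hy) as [x [Hx Hxy]]. now apply (H x).
Qed.

Lemma KX_open_hits (U : X -> Prop) :
  open_set d U -> KX_open d (fun K => exists x, K x /\ U x).
Proof.
  intros HU K HK [x [Hx HUx]]. destruct (HU x HUx) as [e [He H]].
  exists e. split; [exact He|]. intros L HL HKL.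
  destruct (proj1 (dH_lt K L e HK HL HKL) x Hx) as [y [Hy Hxy]].
  exists y. split; [exact Hy|now apply H].
Qed.

(** The complement of the closure of [P]. Unlike the negation of an open [P] it is an open
    condition, so it can be part of a dense open set. *)
Definition KX_exterior (P : (X -> Prop) -> Prop) (K : X -> Prop) : Prop :=
  exists e, 0 < e /\ forall L, in_KX d L -> dH d K L < e -> ~ P L.

Lemma KX_exterior_open (P : (X -> Prop) -> Prop) : KX_open d (KX_exterior P).
Proof.
  intros K HK [e [He H]]. exists (e / 3). split; [lra|].
  intros L HL HKL. exists (e / 3). split; [lra|]. intros M HM HLM.
  apply H; [exact HM|].
  pose proof (dH_triangle_lt K L M _ _ HK HL HM HKL HLM). lra.
Qed.

Lemma KX_exterior_not (P : (X -> Prop) -> Prop) (K : X -> Prop) :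
  in_KX d K -> KX_exterior P K -> ~ P K.
Proof.
  intros HK [e [He H]]. apply H; [exact HK|]. apply dH_refl_lt; [apply HK|exact He].
Qed.

(** * Patterns *)

Definition isolated (x : X) : Prop := exists e, 0 < e /\ forall y, d x y < e -> y = x.

Lemma open_isolated_or (U : X -> Prop) :
  open_set d U -> open_set d (fun x => isolated x \/ U x).
Proof.
  intros HU x [Hx|Hx].
  - pose proof Hx as [e [He H]]. exists e. split; [exact He|].
    intros y Hy. left. now rewrite (H y Hy).
  - destruct (HU x Hx) as [e [He H]]. exists e. split; [exact He|]. auto.
Qed.

(** Singletons of isolated points are open, so together with [U] they form an open cover, and a
    finite subcover leaves only finitely many points outside [U]. In the cover, [Some y] stands for
    a singleton and [None] for [U]. *)
Lemma compact_isolated_or (K U : X -> Prop) :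
  compact_set d K -> open_set d U -> (forall x, K x -> isolated x \/ U x) ->
  exists l, forall x, K x -> In x l \/ U x.
Proof.
  intros HK HU H.
  destruct (HK (option X) (fun o x => match o with
    | Some y => isolated y /\ x = y | None => U x end)) as [l Hl].
  - intros [y|]; [|exact HU]. intros x [Hy ->]. pose proof Hy as [e [He Hye]].
    exists e. split; [exact He|]. auto.
  - intros x Hx. destruct (H x Hx) as [Hi|Hi]; [now exists (Some x)|now exists None].
  - exists (flat_map (fun o => match o with Some y => [y] | None => [] end) l).
    intros x Hx. destruct (Hl x Hx) as [[y|] [Hin Hy]]; [|now right].
    left. apply in_flat_map. exists (Some y). split; [exact Hin|].
    destruct Hy as [_ ->]. now left.
Qed.

Lemma nonisolated_close (y : X) (e : R) (l : list X) (D : X -> Prop) :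
  (forall x e, 0 < e -> exists z, D z /\ d x z < e) ->
  ~ isolated y -> 0 < e -> exists z, D z /\ d y z < e /\ ~ In z l.
Proof.
  intros HD Hy He.
  (* Within distance [f] of [y] the list contains at most [y] itself, so it suffices to find a point
     of [D] there that differs from [y]. *)
  destruct (uniform_threshold (fun w t => d y w < t -> w = y) l) as [f [Hf H]].
  { intros w _. destruct (classic (w = y)) as [Hw|Hw]; [exists 1; split; [lra|auto]|].
    exists (d y w). split; [apply metric_neq_pos; auto|]. intros t Ht Hlt. lra. }
  pose proof (Rmin_l e f). pose proof (Rmin_r e f). pose proof (Rmin_pos e f He Hf).
  assert (exists x, 0 < d y x < Rmin e f) as [x Hx].
  { apply NNPP. intros Hn. apply Hy. exists (Rmin e f). split; [assumption|].
    intros z Hz. apply NNPP. intros Hzy. apply Hn. exists z. split; [|exact Hz].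
    apply metric_neq_pos. auto. }
  (* The first bound forces [z] to differ from [y], the second keeps it within [Rmin e f] of [y]. *)
  destruct (HD x (Rmin (d y x) (Rmin e f - d y x))) as [z [Hz Hxz]].
  { apply Rmin_pos; lra. }
  pose proof (Rmin_l (d y x) (Rmin e f - d y x)). pose proof (Rmin_r (d y x) (Rmin e f - d y x)).
  pose proof (metric_triangle y x z). pose proof (metric_triangle y z x).
  rewrite (metric_sym z x) in *.
  exists z. split; [exact Hz|]. split; [lra|]. intros Hin.
  assert (z = y) as ->; [apply (H z f Hin); lra|].
  rewrite metric_refl in *. lra.
Qed.

(** Near a non-isolated point there are infinitely many points of [D], so even repeated entries of
    [Y] receive distinct approximations. *)
Lemma distinct_approximation (D : X -> Prop) (Y : list X) (e : R) :
  (forall x e, 0 < e -> exists z, D z /\ d x z < e) -> 0 < e ->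
  (forall y, In y Y -> ~ isolated y) ->
  exists A, length A = length Y /\ NoDup A /\
    (forall a, In a A -> D a /\ exists y, In y Y /\ d y a < e) /\
    (forall y, In y Y -> exists a, In a A /\ d y a < e).
Proof.
  intros HD He. induction Y as [|y Y IH]; intros HY.
  - exists []. split; [reflexivity|]. split; [constructor|]. split; [intros a []|intros y []].
  - destruct IH as [A [H1 [H2 [H3 H4]]]]; [intros z Hz; apply HY; now right|].
    destruct (nonisolated_close y e A D HD) as [z [Hz [Hyz Hn]]]; auto; [apply HY; now left|].
    exists (z :: A). split; [simpl; now rewrite H1|]. split; [now constructor|]. split.
    + intros a [<-|Ha].
      * split; [exact Hz|]. exists y. split; [now left|exact Hyz].
      * destruct (H3 a Ha) as [Hp [b [Hb Hba]]]. split; [exact Hp|].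
        exists b. split; [now right|exact Hba].
    + intros b [<-|Hb]; [exists z; split; [now left|exact Hyz]|].
      destruct (H4 b Hb) as [a [Ha Hba]]. exists a. split; [now right|exact Hba].
Qed.

(** The separation is coded by a natural number so that the patterns with centers in a countable set
    are countable. *)
Record pattern : Type := Pattern { centers : list X; level : nat }.

Definition sep (c : pattern) : R := / INR (S (level c)).

(** Dividing by the number [N] of centers makes [N * (1 / N + 2 * radius c / sep c)] equal to 3,
    whatever the pattern. *)
Definition radius (c : pattern) : R := sep c / INR (length (centers c)).

(** The clause on isolated points lets every point of a ball be approximated by arbitrarily many new
    centers. The last clause puts points of different balls more than [sep c] apart. *)
Definition valid (D : X -> Prop) (c : pattern) : Prop :=
  centers c <> [] /\ NoDup (centers c) /\
  (forall g, In g (centers c) -> D g) /\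
  (forall g x, In g (centers c) -> d g x < radius c -> ~ isolated x) /\
  (forall g g', In g (centers c) -> In g' (centers c) -> g <> g' ->
     sep c + 2 * radius c <= d g g').

Definition models (c : pattern) (K : X -> Prop) : Prop :=
  subset K (fun x => isolated x \/ exists g, In g (centers c) /\ d g x < radius c) /\
  (forall g, In g (centers c) -> exists x, K x /\ d g x < radius c).

(* Splitting every center into the same number of children is what makes the
   limiting mass distribution uniform on each level. *)
Definition refines (c c' : pattern) : Prop :=
  (level c < level c')%nat /\
  exists (M : nat) (children : X -> list X), (2 <= M)%nat /\
    centers c' = flat_map children (centers c) /\
    forall g, In g (centers c) -> length (children g) = M /\
      forall p, In p (children g) -> d g p + radius c' <= radius c.

Lemma sep_pos (c : pattern) : 0 < sep c.
Proof. apply inv_INR_S_pos. Qed.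

Lemma centers_length_pos (c : pattern) : centers c <> [] -> 1 <= INR (length (centers c)).
Proof.
  intros H. apply (le_INR 1). destruct (centers c); [now elim H|simpl; lia].
Qed.

Lemma radius_bounds (c : pattern) : centers c <> [] -> 0 < radius c <= sep c.
Proof.
  intros H. apply centers_length_pos in H. pose proof (sep_pos c). unfold radius. split.
  - apply Rdiv_lt_0_compat; lra.
  - apply Rmult_le_reg_r with (INR (length (centers c))); [lra|].
    unfold Rdiv. rewrite Rmult_assoc, Rinv_l by lra. nra.
Qed.

Lemma open_balls (c : pattern) :
  open_set d (fun x => exists g, In g (centers c) /\ d g x < radius c).
Proof.
  intros x [g [Hg Hx]]. destruct (open_ball g _ x Hx) as [e [He H]].
  exists e. split; [exact He|]. intros y Hy. exists g. auto.
Qed.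

Lemma models_open (c : pattern) : KX_open d (models c).
Proof.
  apply KX_open_and.
  - apply KX_open_subset, open_isolated_or, open_balls.
  - apply KX_open_forall_list. intros g. apply KX_open_hits, open_ball.
Qed.

Lemma small_level (G : list X) (e : R) (n0 : nat) :
  G <> [] -> 0 < e -> exists n, (n0 < n)%nat /\
    radius (Pattern G n) <= e /\
    forall g g', In g G -> In g' G -> g <> g' ->
      sep (Pattern G n) + 2 * radius (Pattern G n) <= d g g'.
Proof.
  intros HG He.
  (* The radius is at most the separation, so [sep + 2 * radius] is at most three times the
     separation. *)
  destruct (uniform_threshold (fun p t => fst p <> snd p -> 3 * t <= d (fst p) (snd p))
    (list_prod G G)) as [f [Hf H]].
  { intros [x y] _. simpl. destruct (classic (x = y)) as [Hxy|Hxy].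
    - exists 1. split; [lra|]. intros t _ Hn. contradiction.
    - exists (d x y / 3). pose proof (metric_neq_pos x y Hxy). split; [lra|]. intros; lra. }
  destruct (inv_INR_S_small (Rmin e f) n0) as [n [Hn Hs]]; [now apply Rmin_pos|].
  pose proof (Rmin_l e f). pose proof (Rmin_r e f).
  exists n. split; [exact Hn|].
  pose proof (radius_bounds (Pattern G n) HG).
  change (/ INR (S n)) with (sep (Pattern G n)) in Hs.
  split; [lra|]. intros g g' Hg Hg' Hne.
  pose proof (H (g, g') (sep (Pattern G n)) (proj2 (in_prod_iff _ _ _ _) (conj Hg Hg'))
    ltac:(lra) Hne) as Hsep. simpl in Hsep. lra.
Qed.

(** * Density of patterns and of their refinements *)

Lemma isolated_approximation (Z : list X) (e : R) :
  exists I, (forall i, In i I -> isolated i /\ exists z, In z Z /\ d z i < e) /\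
    forall z, In z Z -> (exists i, isolated i /\ d z i < e) -> exists i, In i I /\ d z i < e.
Proof.
  induction Z as [|a Z [I [IH1 IH2]]].
  - exists []. split; [intros i []|intros z []].
  - destruct (classic (exists i, isolated i /\ d a i < e)) as [[i [Hi Hai]]|Hn].
    + exists (i :: I). split.
      * intros j [<-|Hj]; [split; [exact Hi|exists a; split; [now left|exact Hai]]|].
        destruct (IH1 j Hj) as [Hj1 [z [Hz Hzj]]]. split; [exact Hj1|].
        exists z. split; [now right|exact Hzj].
      * intros z [<-|Hz] H; [exists i; split; [now left|exact Hai]|].
        destruct (IH2 z Hz H) as [j [Hj Hzj]]. exists j. split; [now right|exact Hzj].
    + exists I. split.
      * intros j Hj. destruct (IH1 j Hj) as [Hj1 [z [Hz Hzj]]]. split; [exact Hj1|].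
        exists z. split; [now right|exact Hzj].
      * intros z [<-|Hz] H; [contradiction|now apply IH2].
Qed.

Definition classically (P : Prop) : bool :=
  if excluded_middle_informative P then true else false.

Lemma classically_true (P : Prop) : classically P = true <-> P.
Proof.
  unfold classically. destruct excluded_middle_informative; split; auto; discriminate.
Qed.

(** Take a finite net of [K]. Net points with an isolated point nearby are moved to one; the
    remaining, lonely points are moved to distinct points of [D], which become the centers. Without
    lonely points the result consists of isolated points only. *)
Lemma valid_pattern_dense (D : X -> Prop) :
  (forall x e, 0 < e -> exists z, D z /\ d x z < e) ->
  KX_dense d (fun K => subset K isolated \/ exists c, valid D c /\ models c K).
Proof.
  intros HD K eps HK Heps. set (e := eps / 3). assert (He : 0 < e) by (unfold e; lra).
  destruct (subset_net K K e) as [Z [HZ1 HZ2]]; [apply HK|intros x; auto|exact He|].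
  destruct (isolated_approximation Z e) as [I [HI1 HI2]].
  set (lonely := fun z => forall i, d z i < e -> ~ isolated i).
  set (Y := filter (fun z => classically (lonely z)) Z).
  assert (HY : forall y, In y Y <-> In y Z /\ lonely y).
  { intros y. unfold Y. now rewrite filter_In, classically_true. }
  destruct (distinct_approximation D Y e HD He) as [G [_ [HG1 [HG2 HG3]]]].
  { intros y Hy. apply HY in Hy. apply (proj2 Hy). now rewrite metric_refl. }
  set (L := fun x => In x I \/ In x G).
  assert (HZL : forall z, In z Z -> exists y, L y /\ d z y < e).
  { intros z Hz. destruct (classic (exists i, isolated i /\ d z i < e)) as [Hi|Hi].
    - destruct (HI2 z Hz Hi) as [i [HiI Hzi]]. exists i. split; [now left|exact Hzi].
    - destruct (HG3 z) as [g [Hg Hzg]]; [|exists g; split; [now right|exact Hzg]].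
      apply HY. split; [exact Hz|]. intros i Hzi Hiso. apply Hi. now exists i. }
  assert (HLne : nonempty_set L).
  { destruct HK as [_ [x Hx]]. destruct (HZ2 x Hx) as [z [Hz _]].
    destruct (HZL z Hz) as [y [Hy _]]. now exists y. }
  exists L. split; [|split].
  - split; [|exact HLne]. apply compact_finite. exists (I ++ G). intros x Hx.
    now apply in_or_app.
  - apply Rle_lt_trans with (e + e); [|unfold e; lra].
    apply dH_le; [apply HK|exact HLne| |].
    + intros x Hx. destruct (HZ2 x Hx) as [z [Hz Hzx]]. destruct (HZL z Hz) as [y [Hy Hzy]].
      exists y. split; [exact Hy|].
      pose proof (metric_triangle x z y). rewrite (metric_sym x z) in *. lra.
    + intros y [Hy|Hy].
      * destruct (HI1 y Hy) as [_ [z [Hz Hzy]]]. exists z. split; [now apply HZ1|lra].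
      * destruct (HG2 y Hy) as [_ [z [Hz Hzy]]]. exists z. split; [|lra].
        apply HZ1. now apply HY in Hz.
  - destruct (classic (G = [])) as [HG0|HG0].
    + left. intros x [Hx|Hx]; [now apply HI1|]. rewrite HG0 in Hx. destruct Hx.
    (* A center lies within [e] of a lonely point, so a small ball around it still avoids all
       isolated points. *)
    + right. destruct (uniform_threshold (fun g t => forall x, d g x < t -> ~ isolated x) G)
        as [f [Hf H]].
      { intros g Hg. destruct (HG2 g Hg) as [_ [y [Hy Hyg]]].
        exists (e - d y g). split; [lra|]. intros t Ht x Hx.
        apply HY in Hy. apply (proj2 Hy). pose proof (metric_triangle y g x). lra. }
      destruct (small_level G f 0 HG0 Hf) as [n [_ [Hr Hsep]]].
      pose proof (radius_bounds (Pattern G n) HG0).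
      exists (Pattern G n). split.
      * split; [exact HG0|]. split; [exact HG1|]. split; [apply HG2|].
        split; [|exact Hsep].
        intros g x Hg Hx. apply (H g (radius (Pattern G n)) Hg); [lra|exact Hx].
      * split.
        -- intros x [Hx|Hx]; [left; now apply HI1|]. right. exists x.
           split; [exact Hx|]. rewrite metric_refl. lra.
        -- intros g Hg. exists g. split; [now right|]. rewrite metric_refl. lra.
Qed.

Lemma NoDup_flat_map {A B : Type} (f : A -> list B) (l : list A) :
  NoDup l -> (forall a, In a l -> NoDup (f a)) ->
  (forall a a' b, In a l -> In a' l -> In b (f a) -> In b (f a') -> a = a') ->
  NoDup (flat_map f l).
Proof.
  induction l as [|a l IH]; intros Hl Hf Hd'; simpl; [constructor|].
  inversion_clear Hl as [|? ? Hn Hl']. apply NoDup_app.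
  - apply Hf. now left.
  - apply IH; [exact Hl'|intros b Hb; apply Hf; now right|].
    intros x y b Hx Hy. apply Hd'; now right.
  - intros b Hb Hb'. apply in_flat_map in Hb'. destruct Hb' as [a' [Ha' Hb']].
    apply Hn. rewrite (Hd' a a' b); auto; [now left|now right].
Qed.

(** This allows one common number of children for all centers of a pattern. *)
Lemma uniform_size {A : Type} (P : A -> nat -> Prop) (l : list A) :
  (forall a, In a l -> exists m, forall M, (m <= M)%nat -> P a M) ->
  exists m, forall M a, (m <= M)%nat -> In a l -> P a M.
Proof.
  induction l as [|a l IH]; intros H.
  - exists 0%nat. intros M a _ [].
  - destruct IH as [m1 H1]; [intros b Hb; apply H; now right|].
    destruct (H a) as [m2 H2]; [now left|].
    exists (m1 + m2)%nat. intros M b HM [<-|Hb]; [apply H2|apply H1]; auto; lia.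
Qed.

(** Inside each ball [L] is replaced by [M] nearby points of [D], the children of the center;
    outside the balls [L] consists of isolated points, which are kept. *)
Lemma refinement_dense (D : X -> Prop) (c : pattern) (L : X -> Prop) (eps : R) :
  (forall x e, 0 < e -> exists z, D z /\ d x z < e) ->
  valid D c -> in_KX d L -> models c L -> 0 < eps ->
  exists c' L', valid D c' /\ refines c c' /\ in_KX d L' /\ models c' L' /\ dH d L L' < eps.
Proof.
  intros HD [Hc1 [Hc2 [Hc3 [Hc4 Hc5]]]] HL [HM1 HM2] Heps.
  set (e := eps / 3). assert (He : 0 < e) by (unfold e; lra).
  set (Lg := fun g x => L x /\ d g x < radius c).
  pose (good := fun g M A => length A = M /\ NoDup A /\
    (forall a, In a A -> D a /\ d g a < radius c /\ exists y, L y /\ d y a < e) /\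
    (forall x, Lg g x -> exists a, In a A /\ d x a <= e + e)).
  destruct (uniform_size (fun g M => exists A, good g M A) (centers c)) as [m Hm].
  { intros g Hg. destruct (subset_net L (Lg g) e) as [Z [HZ1 HZ2]];
      [apply HL|intros x; unfold Lg; tauto|exact He|].
    destruct (HM2 g Hg) as [x0 Hx0].
    exists (length Z). intros M HM.
    (* Padding the net with copies of one point brings the number of children to exactly [M], while
       they remain distinct. *)
    set (Y := Z ++ repeat x0 (M - length Z)).
    assert (HY : forall y, In y Y -> Lg g y).
    { intros y Hy. apply in_app_or in Hy as [Hy|Hy]; [now apply HZ1|].
      apply repeat_spec in Hy. now subst y. }
    destruct (uniform_threshold (fun y t => d g y + t <= radius c) Y) as [f [Hf H]].
    { intros y Hy. apply HY in Hy as [_ Hy]. exists (radius c - d g y). split; [lra|].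
      intros; lra. }
    pose proof (Rmin_l e f). pose proof (Rmin_r e f). pose proof (Rmin_pos e f He Hf).
    destruct (distinct_approximation D Y (Rmin e f) HD) as [A [HA1 [HA2 [HA3 HA4]]]];
      [assumption| |].
    { intros y Hy. apply (Hc4 g y Hg). now apply HY. }
    exists A. split; [|split; [exact HA2|split]].
    - rewrite HA1. unfold Y. rewrite length_app, repeat_length. lia.
    - intros a Ha. destruct (HA3 a Ha) as [HDa [y [Hy Hya]]]. split; [exact HDa|]. split.
      + pose proof (H y f Hy ltac:(lra)). pose proof (metric_triangle g y a). lra.
      + exists y. split; [now apply HY|lra].
    - intros x Hx. destruct (HZ2 x Hx) as [z [Hz Hzx]].
      destruct (HA4 z) as [a [Ha Hza]]; [apply in_or_app; now left|].
      exists a. split; [exact Ha|].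
      pose proof (metric_triangle x z a). rewrite (metric_sym x z) in *. lra. }
  (* Adding 2 ensures [2 <= M], so that the number of centers at least doubles. *)
  set (M := (m + 2)%nat).
  set (children := fun g => epsilon (inhabits []) (good g M)).
  assert (Hch : forall g, In g (centers c) -> good g M (children g)).
  { intros g Hg. apply epsilon_spec, Hm; [unfold M; lia|exact Hg]. }
  set (G := flat_map children (centers c)).
  assert (HG : forall p, In p G -> exists g, In g (centers c) /\ In p (children g)).
  { intros p Hp. now apply in_flat_map. }
  assert (HGch : forall g p, In g (centers c) -> In p (children g) -> In p G).
  { intros g p Hg Hp. apply in_flat_map. now exists g. }
  assert (Hnd : NoDup G).
  { apply NoDup_flat_map; [exact Hc2|intros g Hg; now apply Hch|].
    (* A common child would bring two centers within [2 * radius c] of each other. *)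
    intros g g' p Hg Hg' Hp Hp'. apply NNPP. intros Hne.
    pose proof (Hc5 g g' Hg Hg' Hne). pose proof (sep_pos c).
    destruct (Hch g Hg) as [_ [_ [H1 _]]]. destruct (Hch g' Hg') as [_ [_ [H2 _]]].
    destruct (H1 p Hp) as [_ [H3 _]]. destruct (H2 p Hp') as [_ [H4 _]].
    pose proof (metric_triangle g p g'). rewrite (metric_sym p g') in *. lra. }
  assert (HG0 : G <> []).
  { intros HG0. destruct (centers c) as [|g l] eqn:Ec; [now apply Hc1|].
    destruct (Hch g) as [Hlen _]; [now left|].
    destruct (children g) as [|p l'] eqn:Ep; [unfold M in Hlen; simpl in Hlen; lia|].
    assert (Hin : In p G) by (apply (HGch g); [now left|rewrite Ep; now left]).
    rewrite HG0 in Hin. destruct Hin. }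
  (* The children lie strictly inside the ball of their center, so small enough balls around them
     stay inside it. *)
  destruct (uniform_threshold (fun p t => forall g, In g (centers c) -> In p (children g) ->
    d g p + t <= radius c) G) as [f [Hf H]].
  { intros p Hp.
    destruct (uniform_threshold (fun g t => In p (children g) -> d g p + t <= radius c)
      (centers c)) as [f [Hf H]].
    - intros g Hg. destruct (classic (In p (children g))) as [Hpg|Hpg].
      + destruct (Hch g Hg) as [_ [_ [H1 _]]]. destruct (H1 p Hpg) as [_ [H2 _]].
        exists (radius c - d g p). split; [lra|]. intros; lra.
      + exists 1. split; [lra|]. intros t _ Hn. contradiction.
    - exists f. split; [exact Hf|]. intros t Ht g Hg Hpg. now apply H. }
  destruct (small_level G f (level c) HG0 Hf) as [n [Hn [Hr Hsep]]].
  pose proof (radius_bounds (Pattern G n) HG0).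
  set (c' := Pattern G n) in *.
  assert (Hin : forall g p, In g (centers c) -> In p (children g) ->
    d g p + radius c' <= radius c).
  { intros g p Hg Hp. apply (H p); auto; [now apply (HGch g)|lra]. }
  set (L' := fun x => In x G \/ (L x /\ isolated x)).
  assert (HL'ne : nonempty_set L').
  { destruct G as [|p l] eqn:EG; [now elim HG0|]. exists p. left. now left. }
  exists c', L'. split; [|split; [|split; [|split]]].
  - split; [exact HG0|]. split; [exact Hnd|]. split; [|split; [|exact Hsep]].
    + intros p Hp. destruct (HG p Hp) as [g [Hg Hpg]]. now apply (Hch g Hg).
    + intros p x Hp Hx. destruct (HG p Hp) as [g [Hg Hpg]]. apply (Hc4 g x Hg).
      pose proof (Hin g p Hg Hpg). pose proof (metric_triangle g p x). lra.
  - split; [exact Hn|]. exists M, children. split; [unfold M; lia|]. split; [reflexivity|].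
    intros g Hg. split; [now apply (Hch g Hg)|]. intros p. now apply Hin.
  - split; [|exact HL'ne]. apply compact_finite.
    (* Only finitely many points of [L] lie outside the balls, and the balls contain no isolated
       point. *)
    destruct (compact_isolated_or L _ (proj1 HL) (open_balls c) HM1) as [I HI].
    exists (G ++ I). intros x Hx. apply in_or_app. destruct Hx as [Hx|[Hx Hiso]]; [now left|].
    right. destruct (HI x Hx) as [Hi|[g [Hg Hgx]]]; [exact Hi|].
    now elim (Hc4 g x Hg Hgx).
  - split.
    + intros x [Hx|[_ Hx]]; [|now left]. right. exists x. split; [exact Hx|].
      rewrite metric_refl. lra.
    + intros p Hp. exists p. split; [now left|]. rewrite metric_refl. lra.
  - apply Rle_lt_trans with (e + e); [|unfold e; lra].
    apply dH_le; [apply HL|exact HL'ne| |].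
    + intros x Hx. destruct (HM1 x Hx) as [Hiso|[g [Hg Hgx]]].
      * exists x. rewrite metric_refl. split; [now right|lra].
      * destruct (Hch g Hg) as [_ [_ [_ H4]]]. destruct (H4 x (conj Hx Hgx)) as [a [Ha Hxa]].
        exists a. split; [left; now apply (HGch g)|exact Hxa].
    + intros y [Hy|[Hy _]]; [|exists y; rewrite metric_refl; split; [exact Hy|lra]].
      destruct (HG y Hy) as [g [Hg Hyg]]. destruct (Hch g Hg) as [_ [_ [H3 _]]].
      destruct (H3 y Hyg) as [_ [_ [z [Hz Hzy]]]]. exists z. split; [exact Hz|lra].
Qed.

(** Either compact sets modelling [c] come close to [K], and one of them can be perturbed to model a
    refinement, or [K] is already in the exterior. *)
Lemma refinement_generic (D : X -> Prop) (c : pattern) :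
  (forall x e, 0 < e -> exists z, D z /\ d x z < e) -> valid D c ->
  let U := fun K => KX_exterior (models c) K \/
    exists c', valid D c' /\ refines c c' /\ models c' K in
  KX_open d U /\ KX_dense d U.
Proof.
  intros HD Hc U. split.
  - intros K HK [H|[c' [H1 [H2 H3]]]].
    + destruct (KX_exterior_open _ K HK H) as [e [He HL]].
      exists e. split; [exact He|]. intros L HL1 HL2. left. now apply HL.
    + destruct (models_open c' K HK H3) as [e [He HL]].
      exists e. split; [exact He|]. intros L HL1 HL2. right. exists c'. auto.
  - intros K eps HK Heps.
    destruct (classic (exists L, in_KX d L /\ dH d K L < eps / 3 /\ models c L))
      as [[L [HL [HKL HM]]]|Hn].
    + destruct (refinement_dense D c L (eps / 3) HD Hc HL HM) as [c' [L' H]]; [lra|].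
      destruct H as [H1 [H2 [H3 [H4 H5]]]].
      exists L'. split; [exact H3|]. split; [|right; exists c'; auto].
      pose proof (dH_triangle_lt K L L' _ _ HK HL H3 HKL H5). lra.
    + exists K. split; [exact HK|]. split; [apply dH_refl_lt; [apply HK|exact Heps]|].
      (* The failed search within [eps / 3] is itself the witness for the exterior. *)
      left. exists (eps / 3). split; [lra|]. intros L HL HKL HM. apply Hn. now exists L.
Qed.

(** * Mass distribution *)

Definition count {A : Type} (P : A -> Prop) (l : list A) : nat :=
  length (filter (fun a => classically (P a)) l).

Lemma count_cons {A : Type} (P : A -> Prop) (a : A) (l : list A) :
  count P (a :: l) = ((if classically (P a) then 1 else 0) + count P l)%nat.
Proof. unfold count. simpl. now destruct (classically (P a)). Qed.

Lemma count_app {A : Type} (P : A -> Prop) (l l' : list A) :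
  count P (l ++ l') = (count P l + count P l')%nat.
Proof. unfold count. now rewrite filter_app, length_app. Qed.

Lemma count_le_length {A : Type} (P : A -> Prop) (l : list A) : (count P l <= length l)%nat.
Proof. apply filter_length_le. Qed.

Lemma count_none {A : Type} (P : A -> Prop) (l : list A) :
  (forall a, In a l -> ~ P a) -> count P l = 0%nat.
Proof.
  induction l as [|a l IH]; intros H; [reflexivity|].
  rewrite count_cons, IH by (intros b Hb; apply H; now right).
  destruct (classically (P a)) eqn:E; [|reflexivity].
  rewrite classically_true in E. elim (H a); [now left|exact E].
Qed.

Lemma count_le_one {A : Type} (P : A -> Prop) (l : list A) :
  NoDup l -> (forall a b, In a l -> In b l -> P a -> P b -> a = b) -> (count P l <= 1)%nat.
Proof.
  induction l as [|a l IH]; intros Hl H; [unfold count; simpl; lia|].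
  inversion_clear Hl as [|? ? Hn Hl']. rewrite count_cons.
  destruct (classically (P a)) eqn:E.
  - rewrite count_none; [lia|]. intros b Hb HPb. rewrite classically_true in E.
    apply Hn. rewrite (H a b); auto; [now left|now right].
  - apply IH; [exact Hl'|]. intros x y Hx Hy. apply H; now right.
Qed.

Lemma count_flat_map {A B : Type} (P : A -> Prop) (Q : B -> Prop) (f : A -> list B)
    (M : nat) (l : list A) :
  (forall a, In a l -> length (f a) = M) ->
  (forall a b, In a l -> In b (f a) -> Q b -> P a) ->
  (count Q (flat_map f l) <= count P l * M)%nat.
Proof.
  induction l as [|a l IH]; intros Hf H; [unfold count; simpl; lia|].
  simpl. rewrite count_app, count_cons.
  assert (IH' : (count Q (flat_map f l) <= count P l * M)%nat).
  { apply IH; [intros b Hb; apply Hf; now right|].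
    intros b x Hb. apply H. now right. }
  destruct (classically (P a)) eqn:E.
  - pose proof (count_le_length Q (f a)) as Hle.
    rewrite (Hf a (or_introl eq_refl)) in Hle. lia.
  - rewrite (count_none Q (f a)); [lia|]. intros b Hb HQ.
    assert (HP : P a) by (apply (H a b); auto; now left).
    rewrite <- classically_true in HP. congruence.
Qed.

Definition touches (c : pattern) (A : X -> Prop) (g : X) : Prop :=
  exists x, A x /\ d g x < radius c.

(** This finite-level quantity stands in for the limiting measure: it does not increase along a
    chain, so no limit has to be constructed. *)
Definition mass (c : pattern) (A : X -> Prop) : R :=
  INR (count (touches c A) (centers c)) / INR (length (centers c)).

Lemma mass_le_one (c : pattern) (A : X -> Prop) : centers c <> [] -> mass c A <= 1.
Proof.
  intros H. apply centers_length_pos in H.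
  pose proof (le_INR _ _ (count_le_length (touches c A) (centers c))).
  apply Rmult_le_reg_r with (INR (length (centers c))); [lra|].
  unfold mass, Rdiv. rewrite Rmult_assoc, Rinv_l by lra. lra.
Qed.

Lemma refines_length (c c' : pattern) :
  refines c c' -> (2 * length (centers c) <= length (centers c'))%nat.
Proof.
  intros [_ [M [ch [HM [-> H]]]]].
  rewrite (flat_map_constant_length (c := M)) by (intros g Hg; now apply H). nia.
Qed.

(** The ball of a child lies in the ball of its parent, so a touched child has a touched parent; as
    all parents have [M] children, the touched share cannot grow. *)
Lemma mass_refines (c c' : pattern) (A : X -> Prop) :
  centers c <> [] -> refines c c' -> mass c' A <= mass c A.
Proof.
  intros Hc [_ [M [ch [HM [Ec' H]]]]]. apply centers_length_pos in Hc. unfold mass.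
  rewrite Ec'. rewrite (flat_map_constant_length (c := M)) by (intros g Hg; now apply H).
  assert (Hcnt : (count (touches c' A) (flat_map ch (centers c))
    <= count (touches c A) (centers c) * M)%nat).
  { apply count_flat_map; [intros g Hg; now apply H|].
    intros g p Hg Hp [x [Hx Hpx]]. exists x. split; [exact Hx|].
    pose proof (proj2 (H g Hg) p Hp). pose proof (metric_triangle g p x). lra. }
  apply le_INR in Hcnt. rewrite mult_INR in *.
  assert (HM0 : 0 < INR M) by (apply lt_0_INR; lia).
  set (n := INR (length (centers c))) in *.
  apply Rmult_le_reg_r with (n * INR M); [nra|].
  replace (INR (count (touches c A) (centers c)) / n * (n * INR M))
    with (INR (count (touches c A) (centers c)) * INR M) by (field; lra).
  unfold Rdiv. rewrite Rmult_assoc, Rinv_l by nra. lra.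
Qed.

(** Points of two different balls are more than [sep c] apart, so [A] touches at most one of
    them. *)
Lemma mass_small_diam (D : X -> Prop) (c : pattern) (A : X -> Prop) (t : R) :
  valid D c -> (forall x y, A x -> A y -> d x y < t) -> t <= sep c ->
  mass c A <= / INR (length (centers c)).
Proof.
  intros [H1 [H2 [_ [_ H5]]]] HA Ht.
  assert (Hcnt : (count (touches c A) (centers c) <= 1)%nat).
  { apply count_le_one; [exact H2|]. intros g g' Hg Hg' [x [Hx Hgx]] [y [Hy Hgy]].
    apply NNPP. intros Hne. pose proof (H5 g g' Hg Hg' Hne).
    pose proof (HA x y Hx Hy). pose proof (metric_triangle g x g').
    pose proof (metric_triangle x y g'). rewrite (metric_sym y g') in *. lra. }
  apply le_INR in Hcnt. simpl in Hcnt. apply centers_length_pos in H1.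
  assert (0 < / INR (length (centers c))) by (apply Rinv_0_lt_compat; lra).
  unfold mass, Rdiv. nra.
Qed.

Definition chain (D : X -> Prop) (c : nat -> pattern) : Prop :=
  forall k, valid D (c k) /\ refines (c k) (c (S k)).

Lemma chain_mass_antitone (D : X -> Prop) (c : nat -> pattern) (A : X -> Prop) (j k : nat) :
  chain D c -> (j <= k)%nat -> mass (c k) A <= mass (c j) A.
Proof.
  intros Hc Hjk. induction Hjk as [|k _ IH]; [lra|].
  apply Rle_trans with (2 := IH). destruct (Hc k) as [[Hne _] Hr]. now apply mass_refines.
Qed.

Lemma chain_level (D : X -> Prop) (c : nat -> pattern) (k : nat) :
  chain D c -> (k <= level (c k))%nat.
Proof.
  intros Hc. induction k as [|k IH]; [lia|]. destruct (Hc k) as [_ [Hl _]]. lia.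
Qed.

Lemma chain_length (D : X -> Prop) (c : nat -> pattern) (k : nat) :
  chain D c -> (k < length (centers (c k)))%nat.
Proof.
  intros Hc. induction k as [|k IH].
  - destruct (Hc 0%nat) as [[Hne _] _]. destruct (centers (c 0%nat)); [now elim Hne|simpl; lia].
  - destruct (Hc k) as [_ Hr]. apply refines_length in Hr. lia.
Qed.

Lemma chain_sep (D : X -> Prop) (c : nat -> pattern) (j k : nat) :
  chain D c -> (k <= j)%nat -> sep (c j) <= / INR (S k).
Proof.
  intros Hc Hkj. pose proof (chain_level D c j Hc). unfold sep.
  apply Rinv_le_contravar; [apply lt_0_INR; lia|apply le_INR; lia].
Qed.

(** If [t] exceeds the separation at level [j], the linear term is at least 1 and the mass at most
    1. Otherwise, for [j <= k], at most one ball of level [j] is touched, and passing to level [k]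
    does not increase the mass. *)
Lemma chain_mass_le (D : X -> Prop) (c : nat -> pattern) (A : X -> Prop) (t : R) (j k : nat) :
  chain D c -> (forall x y, A x -> A y -> d x y < t) -> / INR (S k) <= t ->
  mass (c k) A <= / INR (length (centers (c j))) + INR (S (level (c j))) * t.
Proof.
  intros Hc HA Hk.
  pose proof (inv_INR_S_pos k). pose proof (sep_pos (c j)) as Hs.
  destruct (Hc j) as [Hj _]. pose proof (centers_length_pos _ (proj1 Hj)) as HN.
  assert (Hinv : 0 < / INR (length (centers (c j)))) by (apply Rinv_0_lt_compat; lra).
  assert (Hb : 0 < INR (S (level (c j)))) by (apply lt_0_INR; lia).
  destruct (Rle_lt_dec t (sep (c j))) as [Ht|Ht].
  - destruct (Nat.le_gt_cases j k) as [Hjk|Hjk].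
    + pose proof (chain_mass_antitone D c A j k Hc Hjk).
      pose proof (mass_small_diam D (c j) A t Hj HA Ht).
      assert (0 <= INR (S (level (c j))) * t) by (apply Rmult_le_pos; lra). lra.
    (* A level finer than [k] has separation at most [/ INR (S k) <= t]; hence [t] equals it and the
       linear term is 1. *)
    + pose proof (chain_sep D c j k Hc ltac:(lia)).
      destruct (Hc k) as [[Hne _] _]. pose proof (mass_le_one (c k) A Hne).
      assert (Et : t = sep (c j)) by lra. rewrite Et. unfold sep. rewrite Rinv_r by lra. lra.
  - destruct (Hc k) as [[Hne _] _]. pose proof (mass_le_one (c k) A Hne).
    enough (1 <= INR (S (level (c j))) * t) by lra.
    rewrite <- (Rinv_r (INR (S (level (c j))))) by lra.
    apply Rmult_le_compat_l; [lra|]. unfold sep in Ht. lra.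
Qed.

(** * Hausdorff measure of a compact set with a chain of patterns *)

Lemma diam_upper (A : X -> Prop) (delta : R) (x y : X) :
  diam_le d A delta -> A x -> A y -> d x y <= diam d A.
Proof.
  intros HA Hx Hy. apply (Rsup_upper _ delta); [|now exists x, y].
  intros r [u [v [Hu [Hv ->]]]]. now apply HA.
Qed.

Lemma diam_empty (A : X -> Prop) : (forall x, ~ A x) -> diam d A = 0.
Proof. intros H. apply Rsup_empty. intros r [x [_ [Hx _]]]. now apply (H x). Qed.

Lemma diam_pos (A : X -> Prop) (delta : R) : diam_le d A delta -> 0 <= diam d A.
Proof.
  intros HA. destruct (classic (exists x, A x)) as [[x Hx]|Hn].
  - rewrite <- (metric_refl x). now apply (diam_upper A delta).
  - rewrite diam_empty; [lra|]. intros x Hx. apply Hn. now exists x.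
Qed.

Lemma diam_bound (A : X -> Prop) (delta : R) :
  0 <= delta -> diam_le d A delta -> diam d A <= delta.
Proof.
  intros Hdelta HA. destruct (classic (exists x, A x)) as [[x Hx]|Hn].
  - apply Rsup_least; [now exists (d x x), x, x|].
    intros r [u [v [Hu [Hv ->]]]]. now apply HA.
  - rewrite diam_empty; [exact Hdelta|]. intros x Hx. apply Hn. now exists x.
Qed.

(** Every [hausdorff_delta] with positive [delta] is squeezed between [u] and [v], so their supremum
    is not [PInf] and is at least [u]. *)
Lemma hausdorff_measure_between (h : R -> R) (K : X -> Prop) (u v : R) :
  0 < u ->
  (forall delta s F, (forall i, diam_le d (F i) delta) ->
     (forall x, K x -> exists i, F i x) ->
     Un_cv (fun n => sum_f_R0 (fun i => h (diam d (F i))) n) s -> u <= s) ->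
  (forall delta, 0 < delta -> exists s F, (forall i, diam_le d (F i) delta) /\
     (forall x, K x -> exists i, F i x) /\
     Un_cv (fun n => sum_f_R0 (fun i => h (diam d (F i))) n) s /\ s <= v) ->
  exists m, hausdorff_measure d h K = Fin m /\ 0 < m.
Proof.
  intros Hu Hlow Hup.
  assert (Hdelta : forall delta, 0 < delta ->
    exists r, hausdorff_delta d h delta K = Fin r /\ u <= r <= v).
  { intros delta Hd0. destruct (Hup delta Hd0) as [s [F [H1 [H2 [H3 H4]]]]].
    unfold hausdorff_delta, ER_inf. destruct excluded_middle_informative as [He|He].
    - eexists. split; [reflexivity|]. split.
      + apply Rinf_greatest; [exact He|]. intros y [F' [H1' [H2' H3']]].
        now apply (Hlow delta y F').
      + apply Rle_trans with (2 := H4). apply (Rinf_lower _ u); [|now exists F].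
        intros y [F' [H1' [H2' H3']]]. now apply (Hlow delta y F').
    - exfalso. apply He. now exists s, F. }
  assert (Hb : forall r, (exists delta, 0 < delta /\ Fin r = hausdorff_delta d h delta K) ->
    r <= v).
  { intros r [delta [H0 Er]]. destruct (Hdelta delta H0) as [r' [Er' Hr']].
    rewrite Er' in Er. injection Er as ->. lra. }
  unfold hausdorff_measure, ER_sup. destruct excluded_middle_informative as [[He|He]|He].
  - destruct He as [delta [H0 Er]]. destruct (Hdelta delta H0) as [r' [Er' _]]. congruence.
  - exfalso. apply He. exists v. exact Hb.
  - eexists. split; [reflexivity|]. apply Rlt_le_trans with (1 := Hu).
    destruct (Hdelta 1 ltac:(lra)) as [r [Er Hr]]. apply Rle_trans with r; [lra|].
    apply (Rsup_upper _ v); [exact Hb|]. exists 1. split; [lra|now symmetry].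
Qed.

(** * Finite sums *)

Lemma term_le_sum (f : nat -> R) (i n : nat) :
  (forall j, 0 <= f j) -> (i <= n)%nat -> f i <= sum_f_R0 f n.
Proof.
  intros Hf. induction n as [|n IH]; intros Hi.
  - replace i with 0%nat by lia. apply Rle_refl.
  - simpl. destruct (Nat.eq_dec i (S n)) as [->|Hne].
    + pose proof (cond_pos_sum f n Hf). lra.
    + pose proof (IH ltac:(lia)). pose proof (Hf (S n)). lra.
Qed.

(** Double counting: every entry contributes at least 1 to the sum. *)
Lemma length_le_sum_count {A : Type} (P : nat -> A -> Prop) (l : list A) (n : nat) :
  (forall a, In a l -> exists i, (i <= n)%nat /\ P i a) ->
  INR (length l) <= sum_f_R0 (fun i => INR (count (P i) l)) n.
Proof.
  induction l as [|a l IH]; intros H.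
  - apply cond_pos_sum. intros i. apply pos_INR.
  - pose proof (IH (fun b Hb => H b (or_intror Hb))) as Hl.
    rewrite (sum_eq _ (fun i => (if classically (P i a) then 1 else 0) + INR (count (P i) l))).
    2: { intros i _. rewrite count_cons, plus_INR. now destruct classically. }
    rewrite sum_plus. destruct (H a (or_introl eq_refl)) as [i [Hi HP]].
    pose proof (term_le_sum (fun i => if classically (P i a) then 1 else 0) i n) as Ht.
    simpl in Ht. rewrite (proj2 (classically_true _) HP) in Ht.
    simpl length. rewrite S_INR.
    enough (1 <= sum_f_R0 (fun i => if classically (P i a) then 1 else 0) n) by lra.
    apply Ht; [|exact Hi]. intros j. destruct classically; lra.
Qed.

Lemma sum_geometric_half (e : R) (n : nat) :
  sum_f_R0 (fun i => e * (/ 2) ^ S i) n = e * (1 - (/ 2) ^ S n).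
Proof.
  induction n as [|n IH]; [simpl; lra|].
  rewrite tech5, IH. rewrite <- (tech_pow_Rmult (/ 2) (S n)). field.
Qed.

(** Finite covers become sequences by padding with the empty set; their partial sums are eventually
    constant. *)
Lemma list_sum_cv (l : list R) :
  Un_cv (fun n => sum_f_R0 (fun i => nth i l 0) n) (fold_right Rplus 0 l).
Proof.
  assert (H : forall n, (length l <= n)%nat ->
    sum_f_R0 (fun i => nth i l 0) n = fold_right Rplus 0 l).
  { induction l as [|a l IH]; intros n Hn.
    - simpl. induction n as [|n IHn]; [reflexivity|]. rewrite tech5, IHn by (simpl; lia).
      simpl. lra.
    - destruct n as [|n]; [simpl in Hn; lia|]. simpl in Hn.
      rewrite decomp_sum by lia. simpl pred. simpl fold_right.
      rewrite <- (IH n) by lia. reflexivity. }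
  intros e He. exists (length l). intros n Hn. rewrite H by lia.
  unfold Rdist. rewrite Rminus_diag, Rabs_R0. exact He.
Qed.

Lemma list_sum_le {A : Type} (f : A -> R) (l : list A) (v : R) :
  (forall a, In a l -> f a <= v) ->
  fold_right Rplus 0 (map f l) <= INR (length l) * v.
Proof.
  induction l as [|a l IH]; intros H; [simpl; lra|].
  simpl length. rewrite S_INR. simpl.
  pose proof (H a (or_introl eq_refl)). pose proof (IH (fun b Hb => H b (or_intror Hb))). lra.
Qed.

Lemma fold_right_Rplus_app (l l' : list R) :
  fold_right Rplus 0 (l ++ l') = fold_right Rplus 0 l + fold_right Rplus 0 l'.
Proof. induction l as [|a l IH]; simpl; [|rewrite IH]; lra. Qed.

(** * The gauge of a chain and the two cover estimates *)

(** The slope [INR (S (level (c k)))] is the inverse of [sep (c k)]. *)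
Definition chain_gauge (c : nat -> pattern) : R -> R :=
  affine_inf (fun k => / INR (length (centers (c k)))) (fun k => INR (S (level (c k)))).

Section Chain.
Context (D : X -> Prop) (c : nat -> pattern) (Hc : chain D c).

Lemma chain_coef_pos (k : nat) : 0 < / INR (length (centers (c k))).
Proof. apply Rinv_0_lt_compat, lt_0_INR. pose proof (chain_length D c k Hc). lia. Qed.

Lemma chain_slope_ge_1 (k : nat) : 1 <= INR (S (level (c k))).
Proof. apply (le_INR 1). lia. Qed.

Lemma chain_coef_small (e : R) : 0 < e -> exists k, / INR (length (centers (c k))) < e.
Proof.
  intros He. destruct (archimed_cor1 e He) as [k [Hk Hk0]]. exists k.
  apply Rle_lt_trans with (2 := Hk).
  pose proof (chain_length D c k Hc).
  apply Rinv_le_contravar; [now apply lt_0_INR|apply le_INR; lia].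
Qed.

Lemma chain_gauge_gauge : gauge (chain_gauge c).
Proof.
  apply affine_inf_gauge;
    [exact chain_coef_pos|exact chain_slope_ge_1|exact chain_coef_small].
Qed.

Lemma chain_gauge_continuous : continuous_on_nonneg (chain_gauge c).
Proof.
  apply affine_inf_continuous;
    [exact chain_coef_pos|exact chain_slope_ge_1|exact chain_coef_small].
Qed.

Lemma chain_gauge_mass (A : X -> Prop) (t : R) (k : nat) :
  (forall x y, A x -> A y -> d x y < t) -> / INR (S k) <= t ->
  mass (c k) A <= chain_gauge c t.
Proof.
  intros HA Hk. apply affine_inf_ge. intros j. now apply (chain_mass_le D).
Qed.

(** Evaluating the [k]-th affine function alone gives 1 from the intercept and 2 from the slope. *)
Lemma chain_gauge_radius (k : nat) :
  INR (length (centers (c k))) * chain_gauge c (2 * radius (c k)) <= 3.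
Proof.
  destruct (Hc k) as [[Hne _] _]. pose proof (radius_bounds _ Hne).
  pose proof (centers_length_pos _ Hne).
  pose proof (affine_inf_le _ _ (2 * radius (c k)) k chain_coef_pos chain_slope_ge_1
    ltac:(lra)) as Hle.
  apply Rmult_le_compat_l with (r := INR (length (centers (c k)))) in Hle; [|lra].
  apply Rle_trans with (1 := Hle). right. unfold radius, sep.
  field. split; [|lra]. apply not_0_INR. lia.
Qed.

Context (K : X -> Prop) (HK : in_KX d K) (HM : forall k, models (c k) K).

Lemma chain_cover_upper (delta : R) : 0 < delta -> exists s F,
  (forall i, diam_le d (F i) delta) /\ (forall x, K x -> exists i, F i x) /\
  Un_cv (fun n => sum_f_R0 (fun i => chain_gauge c (diam d (F i))) n) s /\ s <= 3.
Proof.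
  intros Hdelta. destruct chain_gauge_gauge as [_ [Hmono [_ H0]]].
  assert (Hh0 : chain_gauge c 0 = 0) by (apply H0; lra).
  (* The balls have diameter at most [2 * radius (c k)], and the radius is at most the separation,
     hence at most [/ INR (S k)]. *)
  destruct (inv_INR_S_small (delta / 2) 0) as [k [_ Hk]]; [lra|].
  destruct (Hc k) as [[Hne _] _]. pose proof (radius_bounds _ Hne) as Hr.
  pose proof (chain_sep D c k k Hc (Nat.le_refl k)) as Hs.
  destruct (compact_isolated_or K _ (proj1 HK) (open_balls (c k)) (proj1 (HM k))) as [I HI].
  set (ball := fun g x => d g x < radius (c k)).
  set (Fs := map (fun i x => x = i) I ++ map ball (centers (c k))).
  set (phi := fun A => chain_gauge c (diam d A)).
  assert (Hsing : forall i, diam_le d (fun x => x = i) 0).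
  { intros i x y -> ->. rewrite metric_refl. lra. }
  assert (Hball : forall g, diam_le d (ball g) (2 * radius (c k))).
  { intros g x y Hx Hy. unfold ball in *. pose proof (metric_triangle x g y).
    rewrite (metric_sym x g) in *. lra. }
  exists (fold_right Rplus 0 (map phi Fs)), (fun i => nth i Fs (fun _ => False)).
  split; [|split; [|split]].
  - intros i. destruct (nth_in_or_default i Fs (fun _ => False)) as [Hin| ->];
      [|intros x y []].
    apply in_app_or in Hin. destruct Hin as [Hin|Hin]; apply in_map_iff in Hin;
      destruct Hin as [g [<- _]]; intros x y Hx Hy.
    + pose proof (Hsing g x y Hx Hy). lra.
    + pose proof (Hball g x y Hx Hy). lra.
  - intros x Hx. enough (exists A, In A Fs /\ A x) as [A [HA HAx]].
    { destruct (In_nth Fs A (fun _ => False) HA) as [i [_ Hi]]. exists i. now rewrite Hi. }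
    destruct (HI x Hx) as [Hi|[g [Hg Hgx]]].
    + exists (fun y => y = x). split; [|reflexivity]. apply in_or_app. left.
      now apply (in_map (fun i x => x = i)).
    + exists (ball g). split; [|exact Hgx]. apply in_or_app. right. now apply in_map.
  (* The default entry, the empty set, costs [chain_gauge c 0 = 0], matching the default 0 in
     [list_sum_cv]. *)
  - assert (Hphi0 : phi (fun _ => False) = 0).
    { unfold phi. rewrite diam_empty; [exact Hh0|tauto]. }
    intros e He. destruct (list_sum_cv (map phi Fs) e He) as [N HN].
    exists N. intros n Hn.
    rewrite (sum_eq _ (fun i => nth i (map phi Fs) 0)); [now apply HN|].
    intros i _. rewrite <- Hphi0 at 1. now rewrite map_nth.
  - unfold Fs. rewrite map_app, fold_right_Rplus_app, !map_map.
    pose proof (list_sum_le (fun i => phi (fun x => x = i)) I 0) as H1.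
    pose proof (list_sum_le (fun g => phi (ball g)) (centers (c k))
      (chain_gauge c (2 * radius (c k)))) as H2.
    pose proof (chain_gauge_radius k) as H3.
    apply Rle_trans with (0 + 3); [|lra]. apply Rplus_le_compat.
    + rewrite Rmult_0_r in H1. apply H1. intros i _. unfold phi.
      replace (diam d (fun x => x = i)) with 0; [lra|]. apply Rle_antisym.
      * now apply (diam_pos _ 0).
      * apply diam_bound; [lra|apply Hsing].
    + apply Rle_trans with (2 := H3). apply H2. intros g _. apply Hmono.
      * apply (diam_pos _ _ (Hball g)).
      * apply diam_bound; [lra|apply Hball].
Qed.

(* Fattening the cover to open sets makes it finite; then, on a sufficiently fine
   level, every center is touched, so the masses of the sets add up to at least 1. *)
Lemma chain_cover_lower (delta s : R) (F : nat -> X -> Prop) :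
  (forall i, diam_le d (F i) delta) -> (forall x, K x -> exists i, F i x) ->
  Un_cv (fun n => sum_f_R0 (fun i => chain_gauge c (diam d (F i))) n) s -> 1 <= s.
Proof.
  intros HF Hcov Hcv. destruct chain_gauge_gauge as [Hpos [_ [Hright _]]].
  apply Rnot_lt_le. intros Hlt. set (e := 1 - s). assert (He : 0 < e) by (unfold e; lra).
  (* Right-continuity allows each set to be fattened at a cost of at most [e * (/ 2) ^ S i]; any
     finite number of these costs adds up to less than [e], the assumed gap below 1. *)
  assert (Hu : forall i, exists u, 0 < u /\
    chain_gauge c (diam d (F i) + u) <= chain_gauge c (diam d (F i)) + e * (/ 2) ^ S i).
  { intros i. pose proof (diam_pos _ _ (HF i)) as Hp.
    destruct (Hright _ Hp (e * (/ 2) ^ S i)) as [f [Hf H]].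
    { apply Rmult_lt_0_compat; [exact He|apply pow_lt; lra]. }
    exists (f / 2). split; [lra|].
    pose proof (H (diam d (F i) + f / 2) ltac:(lra)) as Hab.
    apply Rabs_def2 in Hab. lra. }
  apply functional_choice in Hu. destruct Hu as [u Hu].
  (* Fattening by half of [u i] on each side keeps all distances below [t i]. *)
  set (U := fun i y => exists x, F i x /\ d x y < u i / 2).
  set (t := fun i => diam d (F i) + u i).
  assert (Ht : forall i, 0 < t i).
  { intros i. pose proof (diam_pos _ _ (HF i)). destruct (Hu i). unfold t. lra. }
  assert (HU : forall i x y, U i x -> U i y -> d x y < t i).
  { intros i x y [x' [Hx Hxx]] [y' [Hy Hyy]]. pose proof (diam_upper _ _ _ _ (HF i) Hx Hy).
    pose proof (metric_triangle x x' y). pose proof (metric_triangle x' y' y).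
    rewrite (metric_sym x x') in *. unfold t. lra. }
  destruct (proj1 HK nat U) as [l Hl].
  { intros i y [x [Hx Hxy]]. destruct (open_ball x _ y Hxy) as [f [Hf H]].
    exists f. split; [exact Hf|]. intros z Hz. exists x. auto. }
  { intros x Hx. destruct (Hcov x Hx) as [i Hi]. exists i, x. split; [exact Hi|].
    rewrite metric_refl. destruct (Hu i). lra. }
  set (n := list_max l).
  assert (Hn : forall i, In i l -> (i <= n)%nat).
  { apply Forall_forall, list_max_le. apply Nat.le_refl. }
  (* The level [k] must satisfy [/ INR (S k) <= t i] for all indices up to [n], as
     [chain_gauge_mass] demands. *)
  destruct (uniform_threshold (fun i r => r <= t i) (seq 0 (S n))) as [f [Hf Hft]].
  { intros i _. exists (t i). split; [apply Ht|]. intros; lra. }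
  destruct (inv_INR_S_small f 0 Hf) as [k [_ Hk]].
  destruct (Hc k) as [[Hne _] _]. pose proof (centers_length_pos _ Hne) as HN.
  assert (Hcount : INR (length (centers (c k))) <=
    sum_f_R0 (fun i => INR (count (touches (c k) (U i)) (centers (c k)))) n).
  { apply length_le_sum_count. intros g Hg. destruct (proj2 (HM k) g Hg) as [x [Hx Hgx]].
    destruct (Hl x Hx) as [i [Hi Hix]]. exists i. split; [now apply Hn|]. now exists x. }
  assert (Hsum : sum_f_R0 (fun i => INR (count (touches (c k) (U i)) (centers (c k)))) n <=
    sum_f_R0 (fun i => (chain_gauge c (diam d (F i)) + e * (/ 2) ^ S i) *
      INR (length (centers (c k)))) n).
  { apply sum_Rle. intros i Hi.
    assert (Hmass : mass (c k) (U i) <= chain_gauge c (t i)).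
    { apply chain_gauge_mass; [apply HU|]. apply Rle_trans with (1 := Hk).
      apply (Hft i f); [|lra]. apply in_seq. lia. }
    destruct (Hu i) as [_ Hui]. fold (t i) in Hui. unfold mass in Hmass.
    apply Rmult_le_reg_r with (/ INR (length (centers (c k))));
      [apply Rinv_0_lt_compat; lra|].
    rewrite Rmult_assoc, Rinv_r by lra. unfold Rdiv in Hmass. lra. }
  rewrite <- scal_sum, sum_plus, sum_geometric_half in Hsum.
  assert (Hpart : sum_f_R0 (fun i => chain_gauge c (diam d (F i))) n <= s).
  { apply (growing_ineq (fun n => sum_f_R0 (fun i => chain_gauge c (diam d (F i))) n));
      [|exact Hcv].
    intros m. rewrite tech5.
    pose proof (Hpos _ (diam_pos _ _ (HF (S m)))). lra. }
  assert (Hgeo : 0 < (/ 2) ^ S n) by (apply pow_lt; lra).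
  (* A finite geometric sum stays strictly below [e], so the total is strictly below [s + e = 1],
     against the count of all centers. *)
  assert (Hlt1 : sum_f_R0 (fun i => chain_gauge c (diam d (F i))) n +
    e * (1 - (/ 2) ^ S n) < 1) by (unfold e in *; nra).
  nra.
Qed.

Lemma chain_hausdorff_measure :
  exists m, hausdorff_measure d (chain_gauge c) K = Fin m /\ 0 < m.
Proof.
  apply (hausdorff_measure_between _ K 1 3);
    [lra|exact chain_cover_lower|exact chain_cover_upper].
Qed.
End Chain.
End Metric.

(** * Enumeration of patterns *)

Fixpoint decode_list (len code : nat) : list nat :=
  match len with
  | O => []
  | S len' => let (a, code') := Cantor.of_nat code in a :: decode_list len' code'
  end.

Lemma decode_list_surjective (l : list nat) : exists code, decode_list (length l) code = l.
Proof.
  induction l as [|a l [code IH]]; [now exists 0%nat|].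
  exists (Cantor.to_nat (a, code)). cbn [length decode_list].
  now rewrite Cantor.cancel_of_to, IH.
Qed.

(** A code packs the level, the number of centers and their indices under [q]. The number is stored
    because iterated Cantor pairing does not show where a list ends. *)
Lemma patterns_countable {X : Type} (q : nat -> X) :
  exists p : nat -> pattern, forall c, (forall g, In g (centers c) -> exists n, q n = g) ->
    exists m, p m = c.
Proof.
  exists (fun m => let (n, m') := Cantor.of_nat m in let (len, code) := Cantor.of_nat m' in
    Pattern (map q (decode_list len code)) n).
  intros [G n] HG. simpl in HG.
  assert (exists l, map q l = G) as [l <-].
  { induction G as [|g G IH]; [now exists []|].
    destruct IH as [l <-]; [intros x Hx; apply HG; now right|].
    destruct (HG g) as [i <-]; [now left|]. now exists (i :: l). }
  destruct (decode_list_surjective l) as [code Hcode].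
  exists (Cantor.to_nat (n, Cantor.to_nat (length l, code))).
  rewrite Cantor.cancel_of_to, Cantor.cancel_of_to. now rewrite Hcode.
Qed.

(** * The generic compact set *)

Theorem theorem1p1 (X : Type) (d : X -> X -> R) (HX : polish d) :
  KX_generic d (fun K =>
    finite_set K \/
    exists h : R -> R, gauge h /\ continuous_on_nonneg h /\
      exists m, hausdorff_measure d h K = Fin m /\ 0 < m).
Proof.
  destruct HX as [Hd [_ [q Hq]]].
  set (D := fun x => exists n, q n = x).
  assert (HD : forall x e, 0 < e -> exists z, D z /\ d x z < e).
  { intros x e He. destruct (Hq x e He) as [n Hn]. exists (q n). split; [now exists n|exact Hn]. }
  destruct (patterns_countable q) as [p Hp].
  (* Condition 0 supplies a first pattern, condition [S m] a refinement of [p m]. If [p m] is not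
     valid, its condition is vacuous and thus open and dense. *)
  exists (fun i K => match i with
    | O => subset K (isolated d) \/ exists c, valid d D c /\ models d c K
    | S m => valid d D (p m) -> KX_exterior d (models d (p m)) K \/
        exists c', valid d D c' /\ refines d (p m) c' /\ models d c' K
    end).
  split.
  - intros [|m].
    + split; [|now apply valid_pattern_dense].
      assert (Hiso : open_set d (isolated d)).
      { intros x Hx. pose proof Hx as [e [He H]]. exists e. split; [exact He|].
        intros y Hy. now rewrite (H y Hy). }
      intros K HK [H|[c [Hc H]]].
      * destruct (KX_open_subset d Hd _ Hiso K HK H) as [e [He HL]].
        exists e. split; [exact He|]. intros L HL1 HL2. left. now apply HL.
      * destruct (models_open d Hd c K HK H) as [e [He HL]].
        exists e. split; [exact He|]. intros L HL1 HL2. right. exists c. auto.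
    + destruct (classic (valid d D (p m))) as [Hv|Hv].
      * destruct (refinement_generic d Hd D (p m) HD Hv) as [Hopen Hdense]. split.
        -- intros K HK H. destruct (Hopen K HK (H Hv)) as [e [He HL]].
           exists e. split; [exact He|]. intros L HL1 HL2 _. now apply HL.
        -- intros K e HK He. destruct (Hdense K e HK He) as [L [HL1 [HL2 HL3]]].
           exists L. split; [exact HL1|]. split; [exact HL2|]. intros _. exact HL3.
      * split.
        -- intros K _ _. exists 1. split; [lra|]. intros L _ _ H. contradiction.
        -- intros K e HK He. exists K. split; [exact HK|].
           split; [apply dH_refl_lt; auto; apply HK|]. intros H. contradiction.
  - intros K HK HU. destruct (HU 0%nat) as [H|[c0 [Hv0 HM0]]].
    (* With the empty set as [U], a compact set of isolated points is finite. *)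
    + left. destruct (compact_isolated_or d K (fun _ => False) (proj1 HK)) as [l Hl].
      * intros x [].
      * intros x Hx. left. now apply H.
      * exists l. intros x Hx. destruct (Hl x Hx) as [Hin|[]]. exact Hin.
    + right.
      set (state := {c : pattern | valid d D c /\ models d c K}).
      assert (Hstep : forall st : state, exists st' : state,
        refines d (proj1_sig st) (proj1_sig st')).
      (* The set [K] models the current pattern, which rules out the exterior, so its condition
         yields a refinement; iterating the chosen refinement builds the chain. *)
      { intros [c [Hv HM]]. simpl. destruct (Hp c) as [m Hm]; [apply Hv|].
        destruct (HU (S m)) as [Hext|[c' [Hv' [Hr HM']]]]; rewrite Hm in *; [exact Hv| |].
        - now elim (KX_exterior_not d Hd _ K HK Hext).
        - now exists (exist _ c' (conj Hv' HM')). }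
      apply functional_choice in Hstep. destruct Hstep as [next Hnext].
      set (st := fun k => Nat.iter k next (exist _ c0 (conj Hv0 HM0) : state)).
      set (c := fun k => proj1_sig (st k)).
      assert (Hc : chain d D c).
      { intros k. split; [apply (proj2_sig (st k))|]. apply Hnext. }
      assert (HM : forall k, models d (c k) K) by (intros k; apply (proj2_sig (st k))).
      exists (chain_gauge c).
      split; [now apply (chain_gauge_gauge d D)|].
      split; [now apply (chain_gauge_continuous d D)|].
      now apply (chain_hausdorff_measure d Hd D).
Qed.
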